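(* Let $k\geq 1$ and $n\geq 2$ be integers. Then $\operatorname{sdepth}(S/I(P_n^k))=\left\lceil\frac{n}{2k+1}\right\rceil$.
   Context: $K$ is a field and $S=K[x_1,\dots,x_n]$ is the polynomial ring. $P_n^k$ denotes the $k$-th power of the path on the vertex set $\{1,\dots,n\}$: for $1\le i<j\le n$, $\{i,j\}$ is an edge if and only if $j-i\le k$. Its edge ideal is $I(P_n^k)=(x_ix_j : 1\le i<j\le n,\ j-i\le k)\subset S$. Stanley depth: let $M$ be a finitely generated $\mathbb{Z}^n$-graded $S$-module. A Stanley decomposition of $M$ is a presentation of the $K$-vector space $M$ as a finite direct sum $\mathcal{D}: M=\bigoplus_{i=1}^s v_iK[W_i]$, where each $v_i\in M$ is homogeneous, $W_i\subseteq\{x_1,\dots,x_n\}$, $v_iK[W_i]$ is the $K$-subspace generated by all $v_iw$ with $w$ a monomial in $K[W_i]$, and $v_iK[W_i]$ is a free $K[W_i]$-module. Put $\operatorname{sdepth}(\mathcal{D})=\min_i |W_i|$, and $\operatorname{sdepth}(M)=\max\{\operatorname{sdepth}(\mathcal{D}):\mathcal{D}\text{ a Stanley decomposition of }M\}$. *)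

(* Defs.v *)
From HB Require Import structures.
From mathcomp Require Import all_boot all_order all_algebra.
From mathcomp Require Import boolp mpoly.

Set Implicit Arguments.
Unset Strict Implicit.
Unset Printing Implicit Defensive.

Import GRing.Theory Num.Theory.
Local Open Scope ring_scope.
Local Open Scope quotient_scope.

Section IdealGen.
Variables (R : comNzRingType) (T : finType) (P : pred T) (g : T -> R).

Definition ideal_gen : {pred R} :=
  fun p => `[< exists q : T -> R, p = \sum_(t | P t) q t * g t >].

Lemma ideal_genP p :
  reflect (exists q : T -> R, p = \sum_(t | P t) q t * g t) (p \in ideal_gen).
Proof. exact: asboolP. Qed.

Fact ideal_gen_zmod_closed : zmod_closed ideal_gen.
Proof.
split=> [|p q /ideal_genP[a ->] /ideal_genP[b ->]]; apply/ideal_genP.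
  by exists (fun=> 0); rewrite big1 // => t _; rewrite mul0r.
exists (fun t => a t - b t); rewrite -sumrB.
by apply: eq_bigr => t _; rewrite mulrBl.
Qed.
HB.instance Definition _ :=
  GRing.isZmodClosed.Build R ideal_gen ideal_gen_zmod_closed.

Lemma ideal_genM p q : q \in ideal_gen -> p * q \in ideal_gen.
Proof.
move=> /ideal_genP[b ->]; apply/ideal_genP; exists (fun t => p * b t).
by rewrite mulr_sumr; apply: eq_bigr => t _; rewrite mulrA.
Qed.

Lemma mem_ideal_gen t : P t -> g t \in ideal_gen.
Proof.
move=> Pt; apply/ideal_genP; exists (fun t' => (t' == t)%:R).
rewrite (bigD1 t) //= eqxx mul1r big1 ?addr0 // => t' /andP[_ /negbTE ->].
by rewrite mul0r.
Qed.

(* The quotient by [ideal_gen], as an R-module.  The ring structure of        *)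
(* [ring_quotient] is not used: it requires the ideal to be proper.           *)
Definition quot_gen := {ideal_quot ideal_gen}.
HB.instance Definition _ := GRing.Zmodule.on quot_gen.

Definition pi_gen (p : R) : quot_gen := \pi_({ideal_quot ideal_gen}) p.

Lemma pi_genD p q : pi_gen (p + q) = pi_gen p + pi_gen q.
Proof. exact: raddfD. Qed.

Lemma pi_gen_sum (J : Type) (s : seq J) (Q : pred J) (F : J -> R) :
  pi_gen (\sum_(i <- s | Q i) F i) = \sum_(i <- s | Q i) pi_gen (F i).
Proof. exact: raddf_sum. Qed.

Lemma pi_gen_eq p q : (pi_gen p == pi_gen q) = (p - q \in ideal_gen).
Proof. by rewrite Quotient.idealrBE. Qed.

Lemma pi_gen_eq0 p : (pi_gen p == 0) = (p \in ideal_gen).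
Proof.
by rewrite -[p in RHS]subr0 -pi_gen_eq; congr (_ == _); rewrite /pi_gen raddf0.
Qed.

Lemma pi_gen_surj (u : quot_gen) : exists p, u = pi_gen p.
Proof. by exists (repr (u : {ideal_quot ideal_gen})); rewrite /pi_gen reprK. Qed.

Definition scale_gen (p : R) (u : quot_gen) : quot_gen :=
  pi_gen (p * repr (u : {ideal_quot ideal_gen})).

Lemma scale_genE p q : scale_gen p (pi_gen q) = pi_gen (p * q).
Proof.
apply/eqP; rewrite pi_gen_eq -mulrBr ideal_genM // -pi_gen_eq.
by rewrite /pi_gen reprK.
Qed.

Fact scale_genA a b u : scale_gen a (scale_gen b u) = scale_gen (a * b) u.
Proof. by have [p ->] := pi_gen_surj u; rewrite !scale_genE mulrA. Qed.
Fact scale_gen1 : left_id 1 scale_gen.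
Proof. by move=> u; have [p ->] := pi_gen_surj u; rewrite scale_genE mul1r. Qed.
Fact scale_genDr : right_distributive scale_gen +%R.
Proof.
move=> a u v; have [p ->] := pi_gen_surj u; have [q ->] := pi_gen_surj v.
by rewrite -pi_genD !scale_genE mulrDr pi_genD.
Qed.
Fact scale_genDl u : {morph scale_gen^~ u : a b / a + b}.
Proof.
move=> a b; have [p ->] := pi_gen_surj u.
by rewrite !scale_genE mulrDl pi_genD.
Qed.
HB.instance Definition _ := GRing.Zmodule_isLmodule.Build R quot_gen
  scale_genA scale_gen1 scale_genDr scale_genDl.

Lemma pi_genZ p q : pi_gen (p * q) = p *: pi_gen q.
Proof. by rewrite -scale_genE. Qed.

End IdealGen.

Definition multideg (n : nat) (m : 'X_{1..n}) : {ffun 'I_n -> int} :=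
  [ffun i => (m i)%:Z].

Lemma multideg_inj n : injective (@multideg n).
Proof.
move=> m1 m2 /ffunP E; apply/mnmP => i.
by have := E i; rewrite !ffunE => -[].
Qed.

Lemma multidegD n (m1 m2 : 'X_{1..n}) :
  multideg (m1 + m2)%MM = multideg m1 + multideg m2.
Proof. by apply/ffunP => i; rewrite !ffunE mnmDE PoszD. Qed.

(* Finitely generated ZZ^n-graded modules over K[x_1, ..., x_n].              *)
(* [gr_comp a] is the component of degree a.  Closure under scalars from K is *)
(* the case m = 0 of [gr_compZ]; [gr_span] and [gr_indep] say that the module *)
(* is the direct sum of its components.                                       *)
Record grModule (K : fieldType) (n : nat) := GrModule {
  gr_car :> lmodType {mpoly K[n]};
  gr_comp : {ffun 'I_n -> int} -> gr_car -> Prop;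
  gr_comp0 : forall a, gr_comp a 0;
  gr_compD : forall a u v, gr_comp a u -> gr_comp a v -> gr_comp a (u + v);
  gr_compZ : forall a c m u,
    gr_comp a u -> gr_comp (multideg m + a) ((c *: 'X_[m]) *: u);
  gr_span : forall u, exists (s : seq {ffun 'I_n -> int})
                             (f : {ffun 'I_n -> int} -> gr_car),
    (forall a, gr_comp a (f a)) /\ u = \sum_(a <- s) f a;
  gr_indep : forall (s : seq {ffun 'I_n -> int})
                    (f : {ffun 'I_n -> int} -> gr_car),
    uniq s -> (forall a, gr_comp a (f a)) -> \sum_(a <- s) f a = 0 ->
    forall a, a \in s -> f a = 0;
  gr_fingen : exists (r : nat) (e : 'I_r -> gr_car),
    forall u, exists q : 'I_r -> {mpoly K[n]}, u = \sum_i q i *: e i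
}.

Section StanleyDepth.
Variables (K : fieldType) (n : nat).

(* The subalgebra K[W] of K[x_1, ..., x_n], for a set W of variables. *)
Definition subpoly (W : {set 'I_n}) : {pred {mpoly K[n]}} :=
  fun p => all (fun m : 'X_{1..n} => [forall i, (m i != 0%N) ==> (i \in W)])
               (msupp p).

Variable M : grModule K n.

Definition homogeneous (v : M) := exists a, gr_comp a v.

(* vK[W], i.e. the K-span of the elements w v with w a monomial of K[W] *)
Definition stanley_space (v : M) (W : {set 'I_n}) (u : M) :=
  exists2 p, p \in subpoly W & u = p *: v.

Definition stanley_free (v : M) (W : {set 'I_n}) :=
  forall p, p \in subpoly W -> p *: v = 0 -> p = 0.

Record stanley_decomposition := StanleyDecomposition {
  sd_size : nat;
  sd_gen : 'I_sd_size -> M;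
  sd_vars : 'I_sd_size -> {set 'I_n};
  sd_homogeneous : forall i, homogeneous (sd_gen i);
  sd_free : forall i, stanley_free (sd_gen i) (sd_vars i);
  sd_direct : forall u : M, exists! f : {ffun 'I_sd_size -> M},
    (forall i, stanley_space (sd_gen i) (sd_vars i) (f i)) /\ u = \sum_i f i
}.
Arguments sd_gen : clear implicits.
Arguments sd_vars : clear implicits.

(* The neutral value n only matters for the empty decomposition, hence M = 0. *)
Definition sdepth_of (D : stanley_decomposition) : nat :=
  \big[minn/n]_i #|sd_vars D i|.

Lemma sdepth_of_le D : (sdepth_of D <= n)%N.
Proof.
rewrite /sdepth_of; elim/big_rec: _ => // i d _ le_dn.
by rewrite (leq_trans (geq_minr _ _)).
Qed.

(* By [sdepth_of_le] the bound d < n.+1 excludes no decomposition. *)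
Definition sdepth : nat :=
  \max_(d < n.+1 | `[< exists D, sdepth_of D = d >]) d.

Lemma sdepth_ge D : (sdepth_of D <= sdepth)%N.
Proof.
have ltD : (sdepth_of D < n.+1)%N by rewrite ltnS sdepth_of_le.
by apply: (@leq_bigmax_cond _ _ _ (Ordinal ltD)); apply/asboolP; exists D.
Qed.

Lemma sdepth_attained :
  (exists D : stanley_decomposition, True) -> exists D, sdepth_of D = sdepth.
Proof.
case=> D _; have ltD : (sdepth_of D < n.+1)%N by rewrite ltnS sdepth_of_le.
have PD : `[< exists D', sdepth_of D' = Ordinal ltD >].
  by apply/asboolP; exists D.
rewrite /sdepth (bigmax_eq_arg (Ordinal ltD) PD).
by case: arg_maxnP => // d /asboolP.
Qed.

End StanleyDepth.

Section MonomialQuotient.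
Variables (K : fieldType) (n : nat) (T : finType) (P : pred T).
Variable g : T -> {mpoly K[n]}.
Hypothesis g_mon : forall t, exists m : 'X_{1..n}, g t = 'X_[m].

Local Notation S := {mpoly K[n]}.
Local Notation I := (ideal_gen P g).

Lemma msupp_ideal_gen (p : S) m : p \in I -> m \in msupp p -> 'X_[m] \in I.
Proof.
move=> /ideal_genP[q ->]; rewrite mcoeff_msupp raddf_sum /= => nz.
have [t Pt nzt] : exists2 t, P t & (q t * g t)@_m != 0.
  apply: contrapT => no; case/eqP: nz; apply: big1 => t Pt; apply/eqP.
  by apply: contrapT => /negP h; apply: no; exists t.
have [m' gE] := g_mon t.
move: nzt; rewrite -mcoeff_msupp gE (perm_mem (msuppMX _ _)).
case/mapP=> m'' _ ->; rewrite mpolyXD mulrC ideal_genM //.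
by rewrite -gE mem_ideal_gen.
Qed.

(* The component of degree a is the image of the component of degree a of S. *)
Definition quot_comp (a : {ffun 'I_n -> int}) (u : quot_gen P g) : Prop :=
  exists2 p : S, {in msupp p, forall m, multideg m = a} & u = pi_gen P g p.

Fact quot_comp0 a : quot_comp a 0.
Proof.
exists 0; first by move=> m; rewrite msupp0.
by apply/esym/eqP; rewrite pi_gen_eq0 rpred0.
Qed.

Fact quot_compD a u v : quot_comp a u -> quot_comp a v -> quot_comp a (u + v).
Proof.
move=> [p hp ->] [q hq ->]; exists (p + q); last by rewrite pi_genD.
by move=> m /msuppD_le; rewrite mem_cat => /orP[/hp|/hq].
Qed.

Fact quot_compZ a c m u :
  quot_comp a u -> quot_comp (multideg m + a) ((c *: 'X_[m]) *: u).
Proof.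
move=> [p hp ->]; exists ((c *: 'X_[m]) * p); last by rewrite pi_genZ.
move=> m'; rewrite -scalerAl => /msuppZ_le; rewrite mulrC.
rewrite (perm_mem (msuppMX _ _)) => /mapP[m0 /hp <- ->].
by rewrite multidegD.
Qed.

Fact quot_span (u : quot_gen P g) : exists (s : seq {ffun 'I_n -> int})
    (f : {ffun 'I_n -> int} -> quot_gen P g),
  (forall a, quot_comp a (f a)) /\ u = \sum_(a <- s) f a.
Proof.
have [p ->] := pi_gen_surj u.
pose h a := \sum_(m <- msupp p | multideg m == a) p@_m *: 'X_[m].
exists [seq multideg m | m <- msupp p], (fun a => pi_gen P g (h a)); split=> [a|].
  exists (h a) => // m; rewrite /h mcoeff_msupp raddf_sum /=.
  apply: contra_neqP => /eqP ne; rewrite big1 // => m' /eqP dm'.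
  rewrite mcoeffZ mcoeffX; case: eqP => [E|_]; last by rewrite mulr0.
  by rewrite -E dm' eqxx in ne.
rewrite big_map -pi_gen_sum {1}[p]mpolyE; congr pi_gen.
apply: eq_big_seq => m mp; rewrite /h -big_filter.
rewrite (_ : [seq _ <- _ | _] = [:: m]) ?big_seq1 //.
rewrite (eq_filter (a2 := pred1 m)); last first.
  by move=> m'; rewrite /= (inj_eq (@multideg_inj n)).
by rewrite filter_pred1_uniq ?msupp_uniq.
Qed.

Fact quot_indep (s : seq {ffun 'I_n -> int})
    (f : {ffun 'I_n -> int} -> quot_gen P g) :
  uniq s -> (forall a, quot_comp a (f a)) -> \sum_(a <- s) f a = 0 ->
  forall a, a \in s -> f a = 0.
Proof.
move=> us hf.
have [a|p hp] := @choice _ _ (fun a q => {in msupp q, forall m, multideg m = a}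
    /\ f a = pi_gen P g q).
  by have [q] := hf a; exists q.
rewrite (eq_bigr (fun a => pi_gen P g (p a))); last by move=> a _; case: (hp a).
rewrite -pi_gen_sum => /eqP; rewrite pi_gen_eq0 => sI a sa.
rewrite (hp a).2; apply/eqP; rewrite pi_gen_eq0 [p a]mpolyE.
rewrite big_seq; apply: rpred_sum => m mpa.
rewrite -mul_mpolyC ideal_genM //; apply: msupp_ideal_gen sI _.
rewrite mcoeff_msupp raddf_sum /= (bigD1_seq a) //= big1 ?addr0 -?mcoeff_msupp //.
move=> b ba; apply/eqP; rewrite -[_ == 0]negbK -mcoeff_msupp.
apply/negP => mpb; move/eqP: ba; apply.
by rewrite -((hp b).1 _ mpb) ((hp a).1 _ mpa).
Qed.

Fact quot_fingen : exists (r : nat) (e : 'I_r -> quot_gen P g),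
  forall u, exists q : 'I_r -> S, u = \sum_i q i *: e i.
Proof.
exists 1%N, (fun=> pi_gen P g 1) => u; have [p ->] := pi_gen_surj u.
by exists (fun=> p); rewrite big_ord1 -pi_genZ mulr1.
Qed.

Definition monomial_quotient : grModule K n :=
  GrModule quot_comp0 quot_compD quot_compZ quot_span quot_indep quot_fingen.

End MonomialQuotient.

Section EdgeIdeal.
Variables (K : fieldType) (n : nat) (e : rel 'I_n).

Definition edge_pairs : pred ('I_n * 'I_n) :=
  [pred ij : 'I_n * 'I_n | (ij.1 < ij.2)%N & e ij.1 ij.2].

Definition edge_monomial (ij : 'I_n * 'I_n) : {mpoly K[n]} :=
  'X_(ij.1) * 'X_(ij.2).

Fact edge_monomialP ij : exists m : 'X_{1..n}, edge_monomial ij = 'X_[m].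
Proof. by exists (U_(ij.1) + U_(ij.2))%MM; rewrite mpolyXD. Qed.

Definition edge_ideal : {pred {mpoly K[n]}} :=
  ideal_gen edge_pairs edge_monomial.

(* S / I, for I = edge_ideal *)
Definition edge_quotient : grModule K n :=
  monomial_quotient edge_pairs edge_monomialP.

End EdgeIdeal.

(* The k-th power of the path on n vertices, indexed from 0. *)
Definition path_power (n k : nat) : rel 'I_n :=
  fun i j => (i < j <= i + k)%N || (j < i <= j + k)%N.
Arguments path_power : clear implicits.

(* Main.v *)
(* Upper bound: if F is an independent dominating set, the monomial x^F lies in
   some summand v K[W] of any Stanley decomposition.  By freeness x_j x^F is
   nonzero in S/I for j in W, so domination forces W to be contained in F; every
   (2k+1)-st vertex gives such an F of size ceil(n/(2k+1)).
   Lower bound: a partition of the independence complex into intervals [A, B]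
   gives the Stanley decomposition of S/I with summands x^A K[B].  As the first
   vertex is simplicial, there is such a partition with all B maximal independent
   sets, and these have at least ceil(n/(2k+1)) elements because every vertex
   dominates at most 2k+1 vertices. *)
Require Import Defs.
From mathcomp Require Import all_boot all_order all_algebra.
From mathcomp Require Import boolp mpoly zify.
Local Open Scope ring_scope.

Set Implicit Arguments.
Unset Strict Implicit.
Unset Printing Implicit Defensive.

Import Order.TTheory GRing.Theory Num.Theory.

Lemma msupp_sum_ex (R : nzRingType) (n : nat) (T : Type) (s : seq T)
    (P : pred T) (F : T -> {mpoly R[n]}) (m : 'X_{1..n}) :
  m \in msupp (\sum_(t <- s | P t) F t) -> exists2 t, P t & m \in msupp (F t).
Proof.
elim/big_rec: _ => [|t p Pt IH]; first by rewrite msupp0.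
by move/msuppD_le; rewrite mem_cat => /orP[|/IH //]; exists t.
Qed.

(** * Monomials modulo the edge ideal *)

Section Independence.
Variables (n : nat) (e : rel 'I_n).
Implicit Types (F A B : {set 'I_n}) (m : 'X_{1..n}).

Definition indep F : bool :=
  [forall i in F, forall j in F, ~~ ((i < j)%N && e i j)].

Lemma indepP F :
  reflect {in F &, forall i j : 'I_n, (i < j)%N -> ~~ e i j} (indep F).
Proof.
apply: (iffP forall_inP) => [h i j iF jF ij|h i iF].
  by have /forall_inP/(_ j jF) := h i iF; rewrite ij.
by apply/forall_inP => j jF; rewrite negb_and -implybE; apply/implyP/h.
Qed.

Lemma indepS A B : A \subset B -> indep B -> indep A.
Proof.
move=> /subsetP sAB /indepP iB; apply/indepP => i j /sAB + /sAB.
exact: iB.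
Qed.

Definition mnm_supp m : {set 'I_n} := [set i | m i != 0%N].

Definition mnm_ind F : 'X_{1..n} := [multinom nat_of_bool (i \in F) | i < n].

Lemma mnm_indE F i : mnm_ind F i = (i \in F) :> nat.
Proof. exact: mnmE. Qed.

Lemma mnm_supp_ind F : mnm_supp (mnm_ind F) = F.
Proof. by apply/setP => i; rewrite inE mnm_indE; case: (i \in F). Qed.

Lemma mnm_suppD m1 m2 : mnm_supp (m1 + m2)%MM = mnm_supp m1 :|: mnm_supp m2.
Proof. by apply/setP => i; rewrite !inE mnmDE addn_eq0 negb_and. Qed.

Lemma mnm_supp1 (i : 'I_n) : mnm_supp U_(i)%MM = [set i].
Proof. by apply/setP => j; rewrite !inE mnm1E (eq_sym i); case: (j == i). Qed.

Lemma mnm_ind_le F m : (mnm_ind F <= m)%MM = (F \subset mnm_supp m).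
Proof.
apply/mnm_lepP/subsetP => [h i iF|h i].
  by rewrite inE -lt0n; have := h i; rewrite mnm_indE iF.
by rewrite mnm_indE; case: (boolP (i \in F)) => // /h; rewrite inE lt0n.
Qed.

Variable K : fieldType.

(** As the ideal is monomial, this makes the monomials with independent support a K-basis of S/I. *)
Lemma mem_edge_idealX m :
  ('X_[m] \in edge_ideal (K := K) e) = ~~ indep (mnm_supp m).
Proof.
apply/idP/idP.
  case/ideal_genP=> q qE.
  have : m \in msupp ('X_[m] : {mpoly K[n]}) by rewrite msuppX mem_head.
  rewrite qE => /msupp_sum_ex[[i j] /andP[/= ij eij]].
  rewrite /edge_monomial /= -mpolyXD (perm_mem (msuppMX _ _)).
  case/mapP=> m' _ ->; apply/negP => /indepP/(_ i j).
  by rewrite !mnm_suppD !mnm_supp1 !inE !eqxx !orbT eij => /(_ isT isT ij).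
case/forall_inPn=> i iF /forall_inPn[j jF]; rewrite negbK => /andP[ij eij].
have le : (U_(i) + U_(j) <= m)%MM.
  apply/mnm_lepP => l; move: iF jF; rewrite !inE mnmDE !mnm1E.
  by case: (eqVneq i l) ij => [<-|_]; case: (eqVneq j _) => [->|_]; lia.
rewrite -(submK le) mpolyXD [X in _ * X]mpolyXD.
by apply: ideal_genM; apply: (@mem_ideal_gen _ _ _ _ (i, j)); apply/andP.
Qed.

Lemma edge_ideal_supp (p : {mpoly K[n]}) m :
  p \in edge_ideal (K := K) e -> m \in msupp p -> ~~ indep (mnm_supp m).
Proof.
move=> pI mp; rewrite -mem_edge_idealX.
exact: msupp_ideal_gen (@edge_monomialP K n) _ _ pI mp.
Qed.

Lemma subpolyP (W : {set 'I_n}) (p : {mpoly K[n]}) :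
  reflect {in msupp p, forall m, mnm_supp m \subset W} (p \in subpoly (K := K) W).
Proof.
apply: (iffP allP) => h m /h.
  by move/forallP => hm; apply/subsetP => i; rewrite inE; apply/implyP/hm.
move/subsetP => hm; apply/forallP => i; apply/implyP => mi.
by apply: hm; rewrite inE.
Qed.

Notation M := (edge_quotient K e).
Notation pi := (pi_gen (edge_pairs e) (@edge_monomial K n)).

Lemma quotient_eq0 (p : {mpoly K[n]}) :
  (pi p : M) = 0 <-> p \in edge_ideal (K := K) e.
Proof.
split=> [/eqP|pI]; first by rewrite [X in is_true X]pi_gen_eq0.
by apply/eqP; rewrite [X in is_true X]pi_gen_eq0.
Qed.

(** Since [multideg] is injective, each graded component of S is spanned by at most one monomial. *)
Lemma homogeneous_quotient (v : M) :
  homogeneous v -> v != 0 -> exists c m, v = pi (c *: 'X_[m]).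
Proof.
case=> a [p hp ->] nz.
have [p0|] := eqVneq p 0; first by case/eqP: nz; rewrite p0; apply: raddf0.
rewrite -msupp_eq0; case E: (msupp p) => [//|m s] _.
exists p@_m, m; congr (pi _); apply/mpolyP => m'; rewrite mcoeffZ mcoeffX.
have mp : m \in msupp p by rewrite E mem_head.
case: eqP => [->|ne]; first by rewrite mulr1.
rewrite mulr0; apply/memN_msupp_eq0/negP => /hp e1; apply: ne.
by apply: (@multideg_inj n); rewrite e1 (hp _ mp).
Qed.

(** * Upper bound from independent dominating sets *)

Lemma sdepth_of_le_vars (N : grModule K n) (D : stanley_decomposition N)
    (i : 'I_(sd_size D)) :
  (sdepth_of D <= #|sd_vars i|)%N.
Proof.
rewrite /sdepth_of; have := mem_index_enum i; elim: (index_enum _) => //= j s IH.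
rewrite inE big_cons => /predU1P[<-|/IH h]; first exact: geq_minl.
by rewrite (leq_trans (geq_minr _ _)).
Qed.

Lemma sdepth_le_dominating F :
  indep F -> (forall j, j \notin F -> ~~ indep (j |: F)) ->
  (sdepth M <= #|F|)%N.
Proof.
move=> iF domF; apply/bigmax_leqP => d /asboolP[D <-].
have [f [[hf uE] _]] := sd_direct D (pi 'X_[mnm_ind F]).
suff [i sW] : exists i : 'I_(sd_size D), sd_vars i \subset F.
  exact: leq_trans (sdepth_of_le_vars i) (subset_leq_card sW).
have nz (i : 'I_(sd_size D)) : sd_gen i != 0.
  apply/eqP => v0; suff /eqP : (1 : {mpoly K[n]}) = 0 by rewrite oner_eq0.
  apply: (@sd_free _ _ _ D i); last by rewrite v0 scaler0.
  apply/subpolyP => m; rewrite msupp1 inE => /eqP ->.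
  by apply/subsetP => j; rewrite inE mnm0E.
have [i|q hq] := @choice _ _ (fun i q => q \in subpoly (sd_vars i)
    /\ f i = q *: sd_gen i).
  by have [q] := hf i; exists q.
have [i|b hb] := @choice _ _ (fun (i : 'I_(sd_size D)) (b : K * 'X_{1..n}) =>
    sd_gen i = pi (b.1 *: 'X_[b.2])).
  have [c [m E]] := homogeneous_quotient (sd_homogeneous i) (nz i).
  by exists (c, m).
pose g i := q i * ((b i).1 *: 'X_[(b i).2]).
have : pi 'X_[mnm_ind F] = pi (\sum_i g i).
  rewrite uE pi_gen_sum; apply: eq_bigr => i _.
  by rewrite (hq i).2 hb /g pi_genZ.
move/eqP; rewrite pi_gen_eq => inI.
(* The difference lies in I, so none of its monomials has independent support; hence x^F occurs in
   some [g i]. *)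
have : mnm_ind F \notin msupp ('X_[mnm_ind F] - \sum_i g i).
  by apply/negP => /(edge_ideal_supp inI); rewrite mnm_supp_ind iF.
rewrite mcoeff_msupp negbK mcoeffB subr_eq0 => /eqP sg.
have : mnm_ind F \in msupp (\sum_i g i).
  by rewrite mcoeff_msupp -sg -mcoeff_msupp msuppX mem_head.
case/msupp_sum_ex=> i _ gi.
exists i; apply/subsetP => j jW; apply: contraT => /domF jF.
move: gi; rewrite /g -scalerAr => /msuppZ_le; rewrite (perm_mem (msuppMX _ _)).
case/mapP=> m mq Fm.
(* The monomial x_j x^m lies in K[W] and sends the generator to a scalar multiple of x_j x^F, which
   is 0 in S/I. This contradicts freeness. *)
suff /eqP : 'X_[U_(j) + m] = 0 :> {mpoly K[n]} by rewrite -msupp_eq0 msuppX.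
apply: (@sd_free _ _ _ D i); last first.
  rewrite hb -[LHS]pi_genZ -scalerAr -mpolyXD; apply/quotient_eq0.
  rewrite -mul_mpolyC ideal_genM // -addmA (addmC m) -Fm mem_edge_idealX.
  by rewrite mnm_suppD mnm_supp1 mnm_supp_ind.
apply/subpolyP => m'; rewrite msuppX inE => /eqP ->.
rewrite mnm_suppD mnm_supp1 subUset sub1set jW.
by have /subpolyP/(_ _ mq) := (hq i).1.
Qed.

(** * Stanley decompositions from interval partitions *)

Definition in_interval F (AB : {set 'I_n} * {set 'I_n}) : bool :=
  (AB.1 \subset F) && (F \subset AB.2).

Section IntervalPartition.
Variables (L : seq ({set 'I_n} * {set 'I_n})) (d : nat).
Hypothesis L_top : forall AB, AB \in L ->
  [/\ AB.1 \subset AB.2, indep AB.2 & (d <= #|AB.2|)%N].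
(** Counting list entries expresses covering and disjointness at once, and rules out repeated
    intervals. *)
Hypothesis L_count : forall F, indep F -> count (in_interval F) L = 1%N.

Let t (i : 'I_(size L)) := tnth (in_tuple L) i.
Let v i : M := pi 'X_[mnm_ind (t i).1].
Let W i := (t i).2.

Lemma interval_indep F i : in_interval F (t i) -> indep F.
Proof.
case/andP=> _ /indepS; apply.
by have [] := L_top (mem_tnth i (in_tuple L)).
Qed.

Lemma interval_uniq F i j : in_interval F (t i) -> in_interval F (t j) -> i = j.
Proof.
move=> Fi Fj; apply: contraTeq (Fj) => ne.
have := L_count (interval_indep Fi); rewrite -sum1_count big_tnth => E.
apply/negP => {}Fj; move: E; rewrite big_mkcond (bigD1 i) //= Fi.
by rewrite (bigD1 j) 1?eq_sym //= Fj.
Qed.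

Lemma interval_ex F : indep F -> exists i, in_interval F (t i).
Proof.
move=> /L_count E; have : has (in_interval F) L by rewrite has_count E.
case/(has_nthP (set0, set0)) => i lt; exists (Ordinal lt).
by rewrite /t (tnth_nth (set0, set0)).
Qed.

Lemma interval_mon i m :
  mnm_supp m \subset W i -> in_interval (mnm_supp (m + mnm_ind (t i).1)) (t i).
Proof.
move=> mW; have [AB _ _] := L_top (mem_tnth i (in_tuple L)).
by rewrite /in_interval mnm_suppD mnm_supp_ind subsetUr subUset mW.
Qed.

(** The monomials of the i-th term have support in the i-th interval. So distinct terms share no
    monomial, nothing cancels, and every monomial that occurs lies outside I. *)
Lemma interval_independent (r : 'I_(size L) -> {mpoly K[n]}) :
  (forall i, r i \in subpoly (W i)) ->
  \sum_i r i * 'X_[mnm_ind (t i).1] \in edge_ideal (K := K) e ->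
  forall i, r i = 0.
Proof.
move=> hr inI i; apply/eqP; rewrite -msupp_eq0.
case E: (msupp (r i)) => [//|m s].
have mr : m \in msupp (r i) by rewrite E mem_head.
have /subpolyP/(_ _ mr)/interval_mon mi := hr i.
suff /(edge_ideal_supp inI) : (m + mnm_ind (t i).1)%MM
    \in msupp (\sum_i r i * 'X_[mnm_ind (t i).1]).
  by rewrite (interval_indep mi).
rewrite mcoeff_msupp raddf_sum /= (bigD1 i) //= big1 ?addr0 => [|j ji].
  by rewrite addmC mcoeffMX -mcoeff_msupp.
apply/memN_msupp_eq0; rewrite (perm_mem (msuppMX _ _)).
apply/mapP => -[m' m'r Em]; case/eqP: ji; apply: interval_uniq mi.
by rewrite Em addmC; apply: interval_mon; have /subpolyP/(_ _ m'r) := hr j.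
Qed.

(** Each monomial outside I is divided by x^A, for the unique interval [A, B] containing its
    support; the other monomials vanish in S/I. *)
Lemma interval_generate (p : {mpoly K[n]}) :
  exists2 q : 'I_(size L) -> {mpoly K[n]}, forall i, q i \in subpoly (W i)
    & (pi p : M) = \sum_i q i *: v i.
Proof.
pose q i := \sum_(m <- msupp p | in_interval (mnm_supp m) (t i))
  p@_m *: 'X_[m - mnm_ind (t i).1].
exists q => [i|].
  apply/subpolyP => m /msupp_sum_ex[m' /andP[_ mB] /msuppZ_le].
  rewrite msuppX inE => /eqP ->; apply: subset_trans mB.
  by apply/subsetP => l; rewrite !inE mnmBE; lia.
rewrite (eq_bigr (fun i => \sum_(m <- msupp p | in_interval (mnm_supp m) (t i))
    pi (p@_m *: 'X_[m]))) => [|i _]; last first.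
  rewrite -[LHS]pi_genZ /q mulr_suml [LHS]pi_gen_sum.
  apply: eq_bigr => m /andP[Am _]; congr (pi _).
  by rewrite -scalerAl -mpolyXD submK // mnm_ind_le.
rewrite (exchange_big_dep xpredT) //=.
rewrite [in LHS](mpolyE p) [LHS]pi_gen_sum; apply: eq_bigr => m _.
have [im|nim] := boolP (indep (mnm_supp m)).
  have [i mi] := interval_ex im; rewrite (big_pred1 i) // => j.
  by apply/idP/eqP => [/interval_uniq/(_ mi)|->].
rewrite big_pred0 => [|i]; last by apply: contraNF nim => /interval_indep.
apply/quotient_eq0; rewrite -mul_mpolyC ideal_genM //.
by rewrite mem_edge_idealX.
Qed.

Lemma sdepth_ge_partition : (d <= n)%N -> (d <= sdepth M)%N.
Proof.
have hom i : homogeneous (v i).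
  exists (multideg (mnm_ind (t i).1)); exists 'X_[mnm_ind (t i).1] => // m.
  by rewrite msuppX inE => /eqP ->.
have free i : stanley_free (v i) (W i).
  move=> p pW; rewrite -[LHS]pi_genZ => /quotient_eq0 pI.
  have := @interval_independent (fun j => if j == i then p else 0) _ _ i.
  rewrite eqxx; apply=> [j|].
    by case: eqP => [->//|_]; apply/subpolyP => m; rewrite msupp0.
  rewrite (bigD1 i) //= eqxx big1 ?addr0 // => j /negPf ->.
  by rewrite mul0r.
have direct (u : M) : exists! f : {ffun 'I_(size L) -> M},
    (forall i, stanley_space (v i) (W i) (f i)) /\ u = \sum_i f i.
  have [p ->] : exists p, u = pi p by exact: pi_gen_surj.
  have [q qW qE] := interval_generate p.
  exists [ffun i => q i *: v i]; split.
    split=> [i|]; first by exists (q i); rewrite ?ffunE.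
    by rewrite qE; apply: eq_bigr => i _; rewrite ffunE.
  move=> f [hf]; rewrite qE.
  have [i|r hr] := @choice _ _ (fun i r => r \in subpoly (W i) /\ f i = r *: v i).
    by have [r] := hf i; exists r.
  have -> : \sum_i f i = \sum_i r i *: v i by apply: eq_bigr => i _; case: (hr i).
  move=> qr; suff E i : q i = r i.
    by apply/ffunP => i; rewrite ffunE E; case: (hr i).
  apply/eqP; rewrite -subr_eq0; apply/eqP.
  apply: (@interval_independent (fun i => q i - r i)) => [j|].
    apply/subpolyP => m /msuppB_le; rewrite mem_cat => /orP[] mq.
      by have /subpolyP := qW j; apply.
    by have [/subpolyP + _] := hr j; apply.
  apply/quotient_eq0; rewrite [LHS]pi_gen_sum.
  rewrite (eq_bigr (fun i => q i *: v i - r i *: v i)) => [|j _].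
    by rewrite sumrB qr subrr.
  by rewrite -scalerBl -[RHS]pi_genZ.
move=> dn; apply: leq_trans (sdepth_ge (StanleyDecomposition hom free direct)).
(* The assumption [d <= n] covers the neutral value [n] of the minimum. *)
rewrite /sdepth_of /=; elim/big_ind: _ => // [x y|i _].
  by rewrite leq_min => -> ->.
by have [] := L_top (mem_tnth i (in_tuple L)).
Qed.

End IntervalPartition.
End Independence.

(** * Interval partitions for powers of paths *)

Section PathPower.
Variables n k : nat.
Implicit Types F A B : {set 'I_n}.

Lemma indep_pathP F :
  reflect {in F &, forall i j : 'I_n, (i < j)%N -> (i + k < j)%N}
          (indep (path_power n k) F).
Proof.
by apply: (iffP (indepP _ _)) => h i j iF jF ij; have := h i j iF jF ij;
  rewrite /path_power; lia.
Qed.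

(** Restricting to the vertices >= s makes induction possible. Of the maximality of B, only the
    resulting bound on its size is recorded. *)
Definition path_partition s (L : seq ({set 'I_n} * {set 'I_n})) : Prop :=
  (forall AB, AB \in L -> [/\ AB.1 \subset AB.2, indep (path_power n k) AB.2,
     {in AB.2, forall i : 'I_n, s <= i}%N & (n - s <= #|AB.2| * (2 * k + 1))%N])
  /\ (forall F, indep (path_power n k) F -> {in F, forall i : 'I_n, s <= i}%N ->
     count (in_interval F) L = 1%N).

(* Among the vertices >= s, the neighbours s, ..., s + k of s form a clique, so
   an independent set contains at most one of them, v.  If v != s, its link is
   the complex on the vertices > v + k; the remaining faces form the cone with
   apex s over the complex on the vertices > s + k. *)
Lemma path_partition_exists s : exists L, path_partition s L.
Proof.
have [m] := ubnP (n - s); elim: m s => // m IH s sm.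
have [ns|sn] := leqP n s.
  exists [:: (set0, set0)]; split=> [AB|F _ Fs] /=.
    rewrite inE => /eqP -> /=; split=> //; last by lia.
      by apply/indep_pathP => i j; rewrite inE.
    by move=> i; rewrite inE.
  have -> : F = set0.
    by apply/setP => i; rewrite inE; apply/negP => /Fs; have := ltn_ord i; lia.
  by rewrite /in_interval /= subxx.
(* One partition is fixed for every t > s; other t get the default [[::]]. *)
have [t|L' hL'] := @choice _ _ (fun t L => (s < t)%N -> path_partition t L).
  have [st|] := boolP (s < t)%N; last by exists [::].
  by have [|L hL] := IH t; [lia | exists L].
pose s0 := Ordinal sn.
have s0E : s0 = s :> nat by [].
(* For v = s the lower end stays unchanged, so the interval holds faces with and without the apex s;
   for v != s every face must contain v. *)
pose add (v : 'I_n) (AB : {set 'I_n} * {set 'I_n}) :=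
  (if v == s0 then AB.1 else v |: AB.1, v |: AB.2).
pose P (v : 'I_n) := (s <= v <= s + k)%N.
exists (flatten [seq [seq add v AB | AB <- L' (v + k).+1] | v <- enum P]).
split=> [AB|F iF Fs].
  case/flatten_mapP => v; rewrite mem_enum => /andP[sv vs] /mapP[{}AB ABL ->] /=.
  have [|h _] := hL' (v + k).+1; first by lia.
  have [sAB /indep_pathP iB Bv cB] := h _ ABL; split=> /=.
  - by case: ifP => _; [apply: subset_trans sAB (subsetUr _ _) | apply: setUS].
  - apply/indep_pathP => i j /setU1P[->|iB'] /setU1P[->|jB']; last exact: iB.
    + by rewrite ltnn.
    + by have := Bv _ jB'; lia.
    + by have := Bv _ iB'; lia.
  - by move=> i /setU1P[->//|/Bv]; lia.
  - have vB : v \notin AB.2 by apply/negP => /Bv; lia.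
    (* The new vertex v pays for the vertices from s to v + k, at most 2k + 1 of them as v <= s +
       k. *)
    by rewrite cardsU1 vB mulnDl; move: cB; set c := (#|AB.2| * _)%N; lia.
(* The block of v counts F as often as the partition beyond v + k counts F minus v. *)
have one v : P v -> (v \in F) || (v == s0) ->
    {in F, forall i, i != v -> v + k < i}%N ->
    count (in_interval F) [seq add v AB | AB <- L' (v + k).+1] = 1%N.
  move=> Pv vF Fv; have [|h1 h2] := hL' (v + k).+1.
    by move: Pv; rewrite /P; lia.
  rewrite count_map -(h2 (F :\ v)); first last.
  - by move=> i /setD1P[iv /Fv]; apply.
  - by apply: indepS iF; apply: subsetDl.
  apply: eq_in_count => AB /h1[/subsetP sAB _ Bv _].
  rewrite /= /in_interval /add /= subDset subsetD1.
  have -> /= : v \notin AB.1 by apply/negP => /sAB/Bv; lia.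
  by rewrite andbT; case: eqP vF => [//|_]; rewrite orbF subUset sub1set => ->.
(* The block of v misses F: if v != s, its lower ends contain v; if v = s, its upper ends avoid the
   neighbour w of s. *)
have zero v : P v -> v \notin F ->
    (v == s0 -> exists2 w, w \in F & (s < w <= s + k)%N) ->
    count (in_interval F) [seq add v AB | AB <- L' (v + k).+1] = 0%N.
  move=> Pv vF Fv; have [|h1 _] := hL' (v + k).+1.
    by move: Pv; rewrite /P; lia.
  apply/eqP; rewrite -leqn0 leqNgt -has_count.
  apply/hasPn => _ /mapP[AB /h1[_ _ Bv _] ->].
  rewrite /in_interval /add /=; case: eqP => [vs|_]; last first.
    by rewrite subUset sub1set (negPf vF).
  have [|w wF sw] := Fv; first exact/eqP.
  apply/negP => /andP[_ /subsetP/(_ _ wF)/setU1P[wv|/Bv]].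
    by move: sw; rewrite wv vs ltnn.
  by rewrite vs; lia.
rewrite count_flatten -map_comp sumnE big_map big_enum /=.
(* F is counted in the block of its only vertex w in the clique or, if it has none, in the block of
   s. *)
have [w /andP[wF Pw]|none] := pickP [pred w in F | P w].
  have Pv_notin v : P v -> v != w -> v \notin F.
    rewrite neq_ltn /= => Pv vw; apply/negP => vF; move/indep_pathP: iF => iF.
    case/orP: vw => [/(iF _ _ vF wF)|/(iF _ _ wF vF)];
      move: Pv Pw; rewrite /P; lia.
  rewrite (bigD1 w) //= one ?wF // => [|i iF' iw]; last first.
    have := Fs _ iF'; have := contraL (@Pv_notin i ^~ iw) iF'.
    move: iw; rewrite neq_ltn /= => /orP[wi|/(indep_pathP _ iF _ _ wF iF') //].
    by move: Pw; rewrite /P; lia.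
  rewrite big1 // => v /andP[Pv vw]; apply: zero => //; first exact: Pv_notin.
  move=> /eqP vs; exists w => //; move: Pw vw.
  by rewrite /P vs => /andP[]; rewrite -val_eqE /=; lia.
have Pn v : v \in F -> ~~ P v.
  by move=> vF; have := none v; rewrite /= vF => /negbT.
have Ps0 : P s0 by rewrite /P /=; lia.
rewrite (bigD1 s0) //= one ?eqxx ?orbT // => [|i iF' _]; last first.
  by have := Fs _ iF'; have := Pn _ iF'; rewrite /P /=; lia.
rewrite big1 // => v /andP[Pv vs]; apply: zero => //; last by rewrite (negPf vs).
by apply: contraL Pv => /Pn.
Qed.

(** * Stanley depth of path powers *)

Hypothesis n_gt0 : (0 < n)%N.

Lemma sdepth_path (K : fieldType) c :
  (n <= c * (2 * k + 1) < n + (2 * k + 1))%N ->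
  sdepth (edge_quotient K (path_power n k)) = c.
Proof.
move=> hc; have cn : (c <= n)%N by nia.
apply/eqP; rewrite eqn_leq; apply/andP; split; last first.
  have [L [Ltop Lcount]] := path_partition_exists 0.
  apply: (@sdepth_ge_partition _ _ _ L) => // [AB /Ltop[-> -> _ cB]|F iF].
    by split=> //; nia.
  exact: Lcount.
(* Centres of consecutive blocks of 2k + 1 vertices; in a short last block the centre is moved back
   to the last vertex if necessary. *)
pose x (j : nat) := minn (j * (2 * k + 1) + k) n.-1.
have xn j : (x j < n)%N by rewrite /x; lia.
pose F := [set Ordinal (xn j) | j : 'I_c].
(* Since j < c, block j starts at or before n - 1, so even a truncated centre stays in its block. *)
have sep i j : (i < j)%N -> (j < c)%N -> (x i + k < x j)%N.
  by rewrite /x => ij jc; nia.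
apply: leq_trans (_ : #|F| <= _)%N; last first.
  by rewrite (leq_trans (leq_imset_card _ _)) ?card_ord.
apply: sdepth_le_dominating.
  apply/indep_pathP => _ _ /imsetP[i _ ->] /imsetP[j _ ->] /= ij.
  apply: (sep) => //; rewrite ltnNge; apply/negP; rewrite leq_eqVlt.
  case/predU1P => [E|/sep h]; first by move: ij; rewrite E ltnn.
  by have := h (ltn_ord i); lia.
move=> i iF; have jc : (i %/ (2 * k + 1) < c)%N.
  by rewrite ltn_divLR; [have := ltn_ord i; lia | lia].
(* The centre of the block of i is within distance k of i, hence adjacent to it. *)
pose p := Ordinal (xn (i %/ (2 * k + 1))%N).
have pF : p \in F by apply/imsetP; exists (Ordinal jc) => //; apply/val_inj.
have ip : i != p by apply: contraNneq iF => ->.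
have ik : (i <= p + k)%N && (p <= i + k)%N.
  have := divn_eq i (2 * k + 1); have := @ltn_pmod i (2 * k + 1).
  have := ltn_ord i.
  by rewrite /p /x /=; set q := (_ %/ _)%N; set r := (_ %% _)%N; nia.
apply/negP => /indep_pathP h; move: ip; rewrite neq_ltn /= => /orP[] lt.
  by have := h _ _ (setU11 _ _) (setU1r _ pF) lt; lia.
by have := h _ _ (setU1r _ pF) (setU11 _ _) lt; lia.
Qed.

End PathPower.

Theorem theorem3p11 (K : fieldType) (n k : nat) :
  (1 <= k)%N -> (2 <= n)%N ->
  (sdepth (edge_quotient K (path_power n k)))%:Z
    = Num.ceil (n%:Q / (2 * k + 1)%N%:Q).
Proof.
move=> _ n2; have [q qE] : {q | q = (2 * k + 1)%N} by exists (2 * k + 1)%N.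
have q_gt0 : (0 < q)%N by lia.
have [c cP] : {c | (n <= c * q < n + q)%N}.
  (* As q - 1 = 2k, this floor is n / q rounded up. *)
  exists ((n + 2 * k) %/ q)%N.
  have := divn_eq (n + 2 * k) q; have := ltn_pmod (n + 2 * k) q_gt0.
  by move: (_ %/ _)%N (_ %% _)%N => c r; lia.
rewrite (@sdepth_path n k _ K c) -?qE //; last by lia.
apply/esym/ceil_def.
have qQ : 0 < q%:Q by rewrite ltr0z; lia.
rewrite ltr_pdivlMr // ler_pdivrMr // -!rmorphM /= ltr_int ler_int.
by nia.
Qed.
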